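(* For every integer $r\geq 4$, $$\tau(r+2,r)\leq \tfrac14,\qquad \tau(r+3,r)\leq \tfrac18,\qquad \tau(r+5,r)\leq \tfrac1{16}.$$
   Context: An $r$-graph is a pair $H=(V(H),E(H))$ where $V(H)$ is a finite set of vertices and $E(H)$ is a collection of $r$-subsets of $V(H)$. The independence number $\alpha(H)$ is the maximum size of a subset of $V(H)$ which contains no edges of $H$. The degree of a subset $A\subseteq V(H)$ is the number of edges of $H$ containing $A$, and $\Delta_l(H)$ is the maximum degree among $l$-subsets of $V(H)$. Let $$T_{r-1}(n,k,r)=\min\{\Delta_{r-1}(H): H \text{ is an } r\text{-graph with } |V(H)|=n,\ \alpha(H)<k\}.$$ The codegree Turán density is $\tau(k,r)=\lim_{n\to\infty} T_{r-1}(n,k,r)/(n-r+1)$; this limit is known to exist. *)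

(* Defs.v *)
From mathcomp Require Import all_boot all_order all_algebra.
From mathcomp Require Import all_classical all_reals all_analysis.

Set Implicit Arguments.
Unset Strict Implicit.
Unset Printing Implicit Defensive.

Import Order.TTheory GRing.Theory Num.Theory.
Import numFieldNormedType.Exports.

(* A hypergraph on the finite vertex type V is given by its edge set. *)
Section Hypergraph.
Variable V : finType.
Implicit Types (E : {set {set V}}) (A S : {set V}).

Definition rgraph (r : nat) E : bool := [forall e in E, #|e| == r].

Definition independent E S : bool := [forall e in E, ~~ (e \subset S)].

Definition independence_number E : nat := \max_(S | independent E S) #|S|.

Definition degree E A : nat := #|[set e in E | A \subset e]|.

(* Equals 0 when V has no l-subset. *)
Definition max_degree (l : nat) E : nat := \max_(A : {set V} | #|A| == l) degree E A.

Definition complete_rgraph (r : nat) : {set {set V}} := [set e : {set V} | #|e| == r].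

End Hypergraph.

(* T_{r-1}(n, k, r): every r-graph on n vertices is isomorphic to one on 'I_n.
   The complete r-graph serves as the default value demanded by [arg min ...];
   it is a genuine competitor as soon as 0 < r <= k, see codegree_turanP. *)
Definition codegree_turan (n k r : nat) : nat :=
  max_degree r.-1
    [arg min_(E < complete_rgraph 'I_n r
                | rgraph r E && (independence_number E < k)) max_degree r.-1 E].

Lemma rgraph_complete (V : finType) (r : nat) : rgraph r (complete_rgraph V r).
Proof. by apply/forall_inP => e; rewrite inE. Qed.

Lemma independence_number_complete (V : finType) (r k : nat) :
  0 < r <= k -> independence_number (complete_rgraph V r) < k.
Proof.
case: r => [//|r] /= rk; apply: leq_trans rk; rewrite ltnS.
apply/bigmax_leqP => S /forall_inP indS.
rewrite leqNgt; apply/negP => /card_geqP [s [us ss sS]].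
have eK : [set x in s] \in complete_rgraph V r.+1.
  by rewrite inE cardsE (card_uniqP us) ss.
have /negP[] := indS _ eK.
by apply/fintype.subsetP => x; rewrite inE => /sS.
Qed.

Lemma codegree_turanP (n k r : nat) : 0 < r <= k ->
  (exists E : {set {set 'I_n}},
     [/\ rgraph r E, independence_number E < k
       & max_degree r.-1 E = codegree_turan n k r]) /\
  (forall E : {set {set 'I_n}}, rgraph r E -> independence_number E < k ->
     codegree_turan n k r <= max_degree r.-1 E).
Proof.
move=> rk; rewrite /codegree_turan; case: arg_minnP => [|E /andP[rE aE] minE].
  by rewrite rgraph_complete independence_number_complete.
split; first by exists E.
by move=> F rF aF; apply: minE; rewrite rF.
Qed.

Local Open Scope ring_scope.

(* tau(k, r).  The limit is known to exist for 0 < r <= k; limn itself is total,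
   returning a default value on divergent sequences.  The subtraction is taken
   in R, not truncated in nat. *)
Definition codegree_turan_density (R : realType) (k r : nat) : R :=
  limn (fun n : nat => (codegree_turan n k r)%:R / (n%:R - r%:R + 1) : R).

(* Main.v *)
From HB Require Import structures.
Require Import Defs.
From mathcomp Require Import all_boot all_order all_algebra.
From mathcomp Require Import all_classical all_reals all_analysis.
From mathcomp Require Import zify ring lra.

Import Order.TTheory GRing.Theory Num.Theory.
Import numFieldNormedType.Exports.
Local Open Scope ring_scope.

(** Let G be an abelian group of order g, and suppose that any k labels in G,
    repetitions allowed, include r labels with sum zero.  If
    2 <= r <= k, then both tau(k, r) and tau(k + 1, r + 1) are at most 1/g.

    For tau(k, r), distribute the labels evenly over the vertices and take as edges
    the r-sets with label sum zero: r - 1 vertices of an edge determine the label of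
    the last vertex, so the codegree is at most n/g (density_le_zero_sum).

    For tau(k + 1, r + 1), order the vertices and let every vertex v label the
    vertices below it in its own way; an (r + 1)-set with top vertex v is an edge if
    the labels of its other members under v have sum zero.  Any k + 1 vertices
    contain an edge: apply the hypothesis to the labels under their top vertex.  An
    r-set A is completed to an edge by x above A if the labels of A under x have sum
    zero, and by x below the top vertex a of A if the label of x under a has one
    prescribed value.  For labels that behave like independent random ones each
    event has probability about 1/g.  Explicit labels are obtained over a large
    prime field F: a vertex is a triple of a polynomial y of degree less than r, a
    point b and a level, and it is ordered by its level.  The polynomial with
    coefficient sequence u is the code of the vertex u.  The label of u under x is
    obtained by evaluating the code of u at the point of x and the polynomial of x
    at the result, adding a coordinate of u, and mapping F to G with nearly equal
    fibres.  At most points distinct codes have distinct values, and a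
    polynomial of degree less than r takes arbitrary values at r distinct points.
    Hence a vertex can be moved along a line such that the argument of one of the
    labels in question runs through F and the other labels do not change.  These are
    the shifts below; they give card_label_sum_le and card_label_le, and hence
    top_edges_codegree and density_le_zero_sum_succ.

    It remains to see that for even r >= 4 any r + 2, r + 3 or r + 5 labels in the
    elementary abelian groups of order 4, 8 or 16 include r with sum zero.  For r = 4
    this is the pigeonhole principle for sums of pairs (forces_zero_sum4), r = 6 is
    reduced to it by splitting off two equal labels, except for eleven distinct labels
    in the group of order 16 (has_zero_sum6_inj), and r >= 8 follows by removing
    zero-sum quadruples.  Even r is then covered by the first construction and odd r by the
    second one, applied to r - 1. *)

(** * Zero-sum subsets of labels in elementary abelian 2-groups *)

Lemma exists_subset_card (V : finType) (A : {set V}) (m : nat) :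
  (m <= #|A|)%N -> exists2 B : {set V}, B \subset A & #|B| = m.
Proof.
move=> mA; have : (0 < 'C(#|A|, m))%N by rewrite bin_gt0.
rewrite -cards_draws => /card_gt0P[B]; rewrite inE => /andP[sBA /eqP cB].
by exists B.
Qed.

Definition has_zero_sum (G : finZmodType) (V : finType) (f : V -> G) (r : nat)
    (S : {set V}) : Prop :=
  exists e : {set V}, [/\ e \subset S, #|e| = r & \sum_(x in e) f x = 0].

Definition forces_zero_sum (G : finZmodType) (k r : nat) : Prop :=
  forall (V : finType) (f : V -> G) (S : {set V}),
    (k <= #|S|)%N -> has_zero_sum G V f r S.

Arguments has_zero_sum {G V} f r S.

Section ElementaryTwoGroup.
Variable G : finZmodType.
Hypothesis addgg : forall x : G, x + x = 0.

Lemma eq_of_add_eq0 (x y : G) : x + y = 0 -> x = y.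
Proof. by move=> xy0; rewrite -[x]addr0 -(addgg y) addrA xy0 add0r. Qed.

Section Labelling.
Variables (V : finType) (f : V -> G).
Implicit Types (A B S : {set V}).

Lemma has_zero_sumS r S S' : S \subset S' -> has_zero_sum f r S -> has_zero_sum f r S'.
Proof.
by move=> sSS' [e [eS ce se]]; exists e; split=> //; exact: fintype.subset_trans sSS'.
Qed.

Lemma has_zero_sum_cat r1 r2 S A : A \subset S -> #|A| = r1 ->
  \sum_(x in A) f x = 0 -> has_zero_sum f r2 (S :\: A) -> has_zero_sum f (r1 + r2) S.
Proof.
move=> sAS cA sA [e [eS ce se]]; exists (A :|: e).
have dAe : [disjoint A & e].
  by move: eS; rewrite finset.subsetD disjoint_sym => /andP[].
split.
- by rewrite finset.subUset sAS (fintype.subset_trans eS) ?subsetDl.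
- by rewrite cardsU disjoint_setI0 // cards0 subn0 cA ce.
- have -> : \sum_(x in A :|: e) f x = \sum_(x in A) f x + \sum_(x in e) f x.
    by rewrite -bigU //; apply: eq_bigl => x; rewrite !inE.
  by rewrite sA se addr0.
Qed.

Lemma sum_set2 (x y : V) : x != y -> \sum_(z in [set x; y]) f z = f x + f y.
Proof. by move=> xy; rewrite big_setU1 ?inE //= big_set1. Qed.

Lemma has_zero_sum_pair r S (x y : V) : x \in S -> y \in S -> x != y -> f x = f y ->
  has_zero_sum f r (S :\: [set x; y]) -> has_zero_sum f (2 + r) S.
Proof.
move=> xS yS xy fxy; apply: has_zero_sum_cat.
- by rewrite finset.subUset !finset.sub1set xS.
- by rewrite cards2 xy.
- by rewrite sum_set2 // fxy addgg.
Qed.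

Lemma card_setD2 S (x y : V) (m : nat) : (m + 2 <= #|S|)%N -> (m <= #|S :\: [set x; y]|)%N.
Proof.
move=> mS; rewrite -(leq_add2r 2); apply: leq_trans mS _.
rewrite -(cardsID [set x; y] S) addnC leq_add2l.
by rewrite (leq_trans (subset_leq_card (finset.subsetIr _ _))) // cards2; case: (_ != _).
Qed.

Lemma inj_or_equal_pair S : {in S &, injective f} \/
  exists x y, [/\ x \in S, y \in S, x != y & f x = f y].
Proof.
have [/dinjectiveP|] := boolP (dinjectiveb f (mem S)); first by left.
by case/dinjectivePn=> x xS [y /andP[/= yx yS] fxy]; right; exists x, y; rewrite eq_sym; split.
Qed.

(** Two different pairs of points have the same sum as soon as there are more
    pairs than nonzero elements of the group; injectivity of the labelling makes
    these pairs disjoint. *)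
Lemma has_zero_sum4_inj S : {in S &, injective f} -> (#|G| <= 'C(#|S|, 2))%N ->
  has_zero_sum f 4 S.
Proof.
move=> injf cS.
pose P := [set B : {set V} | (B \subset S) && (#|B| == 2)].
pose g (B : {set V}) := \sum_(x in B) f x.
have pairP B : B \in P -> exists x y, [/\ B = [set x; y], x != y, x \in S & y \in S].
  rewrite inE => /andP[BS /cards2P[x [y [xy BE]]]]; exists x, y; split=> //;
  by rewrite !(fintype.subsetP BS) ?BE ?inE ?eqxx ?orbT.
have gP : g @: P \subset [set~ 0].
  apply/fintype.subsetP => _ /imsetP[B /pairP[x [y [-> xy xS yS]]] ->].
  rewrite !inE /g sum_set2 //; apply: contraNneq xy => /eq_of_add_eq0 fxy.
  by rewrite (injf _ _ xS yS fxy).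
have [/dinjectiveP injg|] := boolP (dinjectiveb g (mem P)).
  have G0 : (0 < #|G|)%N by apply/card_gt0P; exists 0.
  have := subset_leq_card gP; rewrite (card_in_imset injg) cards_draws cardsC1.
  by rewrite leqNgt (leq_trans _ cS) ?prednK.
case/dinjectivePn=> B PB [B' /andP[/= nB PB'] gBB'].
have [x [y [BE xy xS yS]]] := pairP B PB.
have [u [v [BE' uv uS vS]]] := pairP B' PB'.
move: gBB' nB; rewrite {}BE {}BE' /g !sum_set2 // => fE nB.
have fxu : x = u -> y = v.
  by move=> xu; move: fE; rewrite xu => /addrI /injf; apply.
have fxv : x = v -> y = u.
  by move=> xv; move: fE; rewrite xv [RHS]addrC => /addrI /injf; apply.
have fyu : y = u -> x = v.
  by move=> yu; move: fE; rewrite yu addrC => /addrI /injf; apply.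
have fyv : y = v -> x = u.
  by move=> yv; move: fE; rewrite yv => /addIr /injf; apply.
have xu : x != u by apply: contraNneq nB => E; rewrite E (fxu E).
have xv : x != v by apply: contraNneq nB => E; rewrite E (fxv E) finset.setUC.
have yu : y != u by apply: contraNneq nB => E; rewrite E (fyu E) finset.setUC.
have yv : y != v by apply: contraNneq nB => E; rewrite E (fyv E).
apply: (has_zero_sum_cat 4 0 S [set x; y; u; v]).
- by rewrite !finset.subUset !finset.sub1set xS yS uS vS.
- by rewrite -!finset.setUA !cardsU1 cards1 !inE !negb_or xy xu xv yu yv uv.
- rewrite -!finset.setUA !big_setU1 ?inE ?negb_or ?xy ?xu ?xv ?yu ?yv //=.
  by rewrite big_set1 addrA fE addgg.
- by exists finset.set0; rewrite finset.sub0set cards0 big_set0.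
Qed.

End Labelling.

(** Split off pairs of points with equal labels, whose sum is zero.  Two disjoint
    such pairs suffice; if there is at most one, the labelling is injective on at
    least m points. *)
Lemma forces_zero_sum4 (m : nat) : (2 <= m)%N -> (#|G| <= 'C(m, 2))%N ->
  forces_zero_sum G (m + 2) 4.
Proof.
move=> m2 Gm V f S cS.
have inj_case (A : {set V}) : (m <= #|A|)%N -> {in A &, injective f} -> has_zero_sum f 4 A.
  move=> mA injf; apply: has_zero_sum4_inj => //; apply: leq_trans Gm _.
  exact: leq_bin2l.
have [injf|[x [y [xS yS xy fxy]]]] := inj_or_equal_pair V f S.
  by apply: inj_case injf; apply: leq_trans cS; rewrite leq_addr.
set S' := S :\: [set x; y]; have mS' : (m <= #|S'|)%N by exact: card_setD2.
have [injf|[u [v [uS vS uv fuv]]]] := inj_or_equal_pair V f S'.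
  by apply: has_zero_sumS (inj_case S' mS' injf); exact: subsetDl.
apply: (has_zero_sum_pair V f 2 S x y) => //.
apply: (has_zero_sum_pair V f 0 S' u v) => //.
by exists finset.set0; rewrite finset.sub0set cards0 big_set0.
Qed.

(** A zero-sum quadruple is removed from the points, and d spare points remain. *)
Lemma forces_zero_sum_add4 (d r : nat) : (4 <= r)%N ->
  forces_zero_sum G (4 + d) 4 -> forces_zero_sum G (r + d) r ->
  forces_zero_sum G (4 + r + d) (4 + r).
Proof.
move=> r4 Z4 Zr V f S cS.
have [|A [AS cA sA]] := Z4 V f S; first by lia.
apply: (has_zero_sum_cat V f 4 r S A) => //; apply: Zr.
by rewrite cardsDS // cA; lia.
Qed.

Lemma forces_zero_sum_even (d r : nat) : (4 <= r)%N -> ~~ odd r ->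
  forces_zero_sum G (4 + d) 4 -> forces_zero_sum G (6 + d) 6 ->
  forces_zero_sum G (r + d) r.
Proof.
move=> r4 r_even Z4 Z6; elim/ltn_ind: r r4 r_even => r IH r4 r_even.
have [->//|->//|r8] : [\/ r = 4%N, r = 6%N | (8 <= r)%N].
  by move: r r4 r_even {IH} => [|[|[|[|[|[|[|[|r]]]]]]]] //=; 
     [constructor 1|constructor 2|constructor 3].
have := forces_zero_sum_add4 d (r - 4); rewrite subnKC //; apply=> //; first lia.
by apply: IH; [lia|lia|rewrite oddB // (negbTE r_even)].
Qed.

(** By the pigeonhole principle two labels agree; they are split off as a zero-sum
    pair. *)
Lemma forces_zero_sum6_large (d : nat) : (#|G| < 6 + d)%N ->
  forces_zero_sum G (4 + d) 4 -> forces_zero_sum G (6 + d) 6.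
Proof.
move=> Gd Z4 V f S cS.
have [injf|[x [y [xS yS xy fxy]]]] := inj_or_equal_pair V f S.
  have := max_card (mem (f @: S)); rewrite (card_in_imset injf) => SG.
  by have := leq_trans Gd (leq_trans cS SG); rewrite ltnn.
apply: (has_zero_sum_pair V f 4 S x y) => //; apply: Z4; apply: card_setD2; lia.
Qed.

End ElementaryTwoGroup.


HB.instance Definition _ (A B : finZmodType) := GRing.Zmodule.on (A * B)%type.

(** Eleven distinct labels: one of the two cosets of H contains at least six of
    them, and the other one at least three.  Among three labels of one coset two
    pairs have distinct sums, so some pair there has a sum d different from the
    sum s of six labels of the larger coset.  Two of these six labels differ by
    s + d, because a subset of more than half of H meets its translates; the four
    others have sum d and complete the pair. *)
Lemma has_zero_sum6_inj (H : finZmodType) (V : finType) (f : V -> bool * H)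
    (S : {set V}) : (forall x : H, x + x = 0) -> #|H| = 8%N ->
  {in S &, injective f} -> (11 <= #|S|)%N -> has_zero_sum f 6 S.
Proof.
move=> addhh cH injf cS.
have addgg (x : bool * H) : x + x = 0.
  by case: x => b x; congr pair; [case: b | exact: addhh].
pose C b := [set x in S | (f x).1 == b].
have injC b : {in C b &, injective (fun x => (f x).2)}.
  move=> x y; rewrite !inE => /andP[xS /eqP xb] /andP[yS /eqP yb] fxy.
  by apply: injf => //; rewrite [f x]surjective_pairing xb -yb fxy -surjective_pairing.
have C8 b : (#|C b| <= 8)%N by rewrite -cH -(card_in_imset (@injC b)) max_card.
have CS : (#|C true| + #|C false| = #|S|)%N.
  rewrite -(cardsID (C true) S); congr (_ + _)%N; apply: eq_card => x; rewrite !inE.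
    by case: (x \in S).
  by case: (x \in S) => //=; case: (f x).1.
have [b [Cb6 Cb3]] : exists b, (6 <= #|C b|)%N /\ (3 <= #|C (~~ b)|)%N.
  have := C8 true; have := C8 false.
  by case: (leqP 6 #|C true|) => ?; [exists true|exists false]; split=> /=; lia.
have [A AC cA] := exists_subset_card V (C b) 6 Cb6.
have [D DC cD] := exists_subset_card V (C (~~ b)) 3 Cb3.
have CS' c : C c \subset S by apply/fintype.subsetP => x; rewrite inE => /andP[].
have AS : A \subset S := fintype.subset_trans AC (CS' b).
have DS : D \subset S := fintype.subset_trans DC (CS' (~~ b)).
have fA1 x : x \in A -> (f x).1 = b.
  by move=> /(fintype.subsetP AC); rewrite inE => /andP[_ /eqP].
have fD1 x : x \in D -> (f x).1 = ~~ b.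
  by move=> /(fintype.subsetP DC); rewrite inE => /andP[_ /eqP].
have dAD : [disjoint A & D].
  apply/pred0P => x /=; apply/negP => /andP[/fA1 xb /fD1]; rewrite xb.
  by case: (b).
have injA : {in A &, injective (fun x => (f x).2)}.
  by move=> x y /(fintype.subsetP AC) xC /(fintype.subsetP AC) yC; apply: (injC b).
pose s := \sum_(x in A) (f x).2.
have [p [q [pD qD pq sd]]] : exists p q, [/\ p \in D, q \in D, p != q & (f p).2 + (f q).2 != s].
  have /card_gt2P[p [q [t [[pD qD tD] [pq qt tp]]]]] : (2 < #|D|)%N by rewrite cD.
  case: (eqVneq ((f p).2 + (f q).2) s) => [pqs|]; last by exists p, q.
  exists p, t; split=> //; first by rewrite eq_sym.
  rewrite -pqs; apply: contraNneq qt => /addrI ftq.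
  by rewrite (injC (~~ b) t q) // (fintype.subsetP DC).
pose d := (f p).2 + (f q).2.
have [u [v [uA vA fuv]]] : exists u v, [/\ u \in A, v \in A & (f u).2 = (f v).2 + (s + d)].
  pose B1 := [set (f x).2 | x in A]; pose B2 := [set (f x).2 + (s + d) | x in A].
  have cB1 : #|B1| = 6%N.
    by rewrite card_in_imset.
  have cB2 : #|B2| = 6%N.
    by rewrite card_in_imset // => x y xA yA /addIr /injA; apply.
  have : (0 < #|B1 :&: B2|)%N.
    have U8 : (#|B1 :|: B2| <= 8)%N by rewrite -cH max_card.
    by have := cardsUI B1 B2; rewrite cB1 cB2; lia.
  case/card_gt0P=> h; rewrite inE => /andP[/imsetP[u uA ->] /imsetP[v vA fuv]].
  by exists u, v.
have uv : u != v.
  apply: contraNneq sd => uv; move: fuv; rewrite uv -[LHS]addr0 => /addrI sd0.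
  by rewrite -/d (eq_of_add_eq0 H addhh s d).
have uvA : [set u; v] \subset A by rewrite finset.subUset !finset.sub1set uA vA.
have sumA2 : \sum_(x in A :\: [set u; v]) (f x).2 = d.
  have fuv_sum : (f u).2 + (f v).2 = s + d by rewrite fuv addrAC addhh add0r.
  apply: (addrI ((f u).2 + (f v).2)); rewrite [in RHS]fuv_sum -[in RHS]addrA addhh addr0.
  rewrite /s [RHS](big_setID [set u; v]) /= (finset.setIidPr uvA).
  by rewrite big_setU1 ?inE //= big_set1.
have pqD : [set p; q] \subset D by rewrite finset.subUset !finset.sub1set pD qD.
have eq_sum (B : {set V}) c : (forall x, x \in B -> (f x).1 = c) -> ~~ odd #|B| ->
    \sum_(x in B) f x = (0, \sum_(x in B) (f x).2).
  move=> fB oddB; rewrite [LHS]surjective_pairing.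
  rewrite (big_morph fst (op1 := +%R) (id1 := 0)) //.
  rewrite (big_morph snd (op1 := +%R) (id1 := 0)) //.
  rewrite (eq_bigr (fun=> c)) // sumr_const.
  rewrite -[in c *+ _](odd_double_half #|B|) (negbTE oddB) add0n -addnn mulrnDr.
  by rewrite -[_ + _]/(addb _ _) addbb.
have cA2 : #|A :\: [set u; v]| = 4%N by rewrite cardsDS // cA cards2 uv.
exists (A :\: [set u; v] :|: [set p; q]).
have dis : [disjoint A :\: [set u; v] & [set p; q]].
  exact: disjointWl (subsetDl _ _) (disjointWr pqD dAD).
split.
- rewrite finset.subUset (fintype.subset_trans (subsetDl _ _)) //.
  exact: fintype.subset_trans pqD DS.
- by rewrite cardsU disjoint_setI0 // cards0 subn0 cA2 cards2 pq.
- have -> : \sum_(x in A :\: [set u; v] :|: [set p; q]) f x =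
      \sum_(x in A :\: [set u; v]) f x + \sum_(x in [set p; q]) f x.
    by rewrite -bigU //; apply: eq_bigl => x; rewrite !inE.
  rewrite (eq_sum _ b) ?cA2 //; last by move=> x /finset.setDP[/fA1].
  rewrite (eq_sum _ (~~ b)) ?cards2 ?pq //; last by move=> x /(fintype.subsetP pqD)/fD1.
  by rewrite sumA2 big_setU1 ?inE //= big_set1; congr pair; exact: addhh.
Qed.

Lemma forces_zero_sum6_16 (H : finZmodType) : (forall x : H, x + x = 0) -> #|H| = 8%N ->
  forces_zero_sum (bool * H)%type 9 4 -> forces_zero_sum (bool * H)%type 11 6.
Proof.
move=> addhh cH Z4 V f S cS.
have addgg (x : bool * H) : x + x = 0.
  by case: x => b x; congr pair; [case: b | exact: addhh].
have [injf|[x [y [xS yS xy fxy]]]] := inj_or_equal_pair _ V f S.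
  exact: has_zero_sum6_inj.
apply: (has_zero_sum_pair _ addgg V f 4 S x y) => //; apply: Z4; apply: card_setD2; lia.
Qed.

Lemma addbool_self (x : bool) : x + x = 0.
Proof. exact: addbb. Qed.

Lemma addprod_self (G H : finZmodType) : (forall x : G, x + x = 0) ->
  (forall x : H, x + x = 0) -> forall x : G * H, x + x = 0.
Proof. by move=> addgg addhh [x y]; congr pair. Qed.

Lemma forces_zero_sum_bool2 (r : nat) : (4 <= r)%N -> ~~ odd r ->
  forces_zero_sum (bool * bool)%type (r + 2) r.
Proof.
move=> r4 r_even.
have addgg := addprod_self _ _ addbool_self addbool_self.
have Z4 : forces_zero_sum (bool * bool)%type (4 + 2) 4.
  by apply: (forces_zero_sum4 _ addgg 4); rewrite // !card_prod card_bool.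
apply: (forces_zero_sum_even _ 2) => //.
by apply: (forces_zero_sum6_large _ addgg 2); rewrite // !card_prod card_bool.
Qed.

Lemma forces_zero_sum_bool3 (r : nat) : (4 <= r)%N -> ~~ odd r ->
  forces_zero_sum (bool * (bool * bool))%type (r + 3) r.
Proof.
move=> r4 r_even.
have addgg := addprod_self _ _ addbool_self (addprod_self _ _ addbool_self addbool_self).
have Z4 : forces_zero_sum (bool * (bool * bool))%type (4 + 3) 4.
  by apply: (forces_zero_sum4 _ addgg 5); rewrite // !card_prod card_bool.
apply: (forces_zero_sum_even _ 3) => //.
by apply: (forces_zero_sum6_large _ addgg 3); rewrite // !card_prod card_bool.
Qed.

Lemma forces_zero_sum_bool4 (r : nat) : (4 <= r)%N -> ~~ odd r ->
  forces_zero_sum (bool * (bool * (bool * bool)))%type (r + 5) r.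
Proof.
move=> r4 r_even.
have addhh := addprod_self _ _ addbool_self (addprod_self _ _ addbool_self addbool_self).
have addgg := addprod_self _ _ addbool_self addhh.
have Z4 : forces_zero_sum (bool * (bool * (bool * bool)))%type (4 + 5) 4.
  by apply: (forces_zero_sum4 _ addgg 7); rewrite // !card_prod card_bool.
apply: (forces_zero_sum_even _ 5) => //.
by apply: forces_zero_sum6_16; rewrite // !card_prod card_bool.
Qed.

(** * Bounds for the codegree density from constructions *)

(** limn has value 0 on a divergent sequence, so that only a convergent one has to
    be considered, and then infinitely many good n suffice. *)
Lemma codegree_turan_density_le (R : realType) (k r g C : nat) : (0 < g)%N ->
  (forall M : nat, exists2 n : nat, (M <= n)%N &
     (g * M * codegree_turan n k r <= n * (M + C))%N) ->
  codegree_turan_density R k r <= 1 / g%:R.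
Proof.
move=> g0 sparse; rewrite /codegree_turan_density.
set u := (fun n : nat => _ : R).
have gR : (0 : R) < g%:R by rewrite ltr0n.
have [cu|ncu] := pselect (cvgn u); last first.
  by rewrite (dvgP ncu) (_ : point = 0) // divr_ge0 // ltW.
rewrite leNgt; apply/negP => lt_lim.
set l := limn u in lt_lim.
pose b : R := (1 / g%:R + l) / 2.
have b_gt : 1 / g%:R < b by rewrite /b; lra.
have b_lt : b < l by rewrite /b; lra.
have [N _ uN] : \forall n \near \oo%classic, b < u n by exact: (cvgr_gt l).
pose c : R := g%:R * b - 1.
have c0 : 0 < c by rewrite /c subr_gt0 -ltr_pdivrMl // mulrC.
have c_ge0 : 0 <= c := ltW c0.
have c1_ge0 : 0 <= 1 + c by rewrite addr_ge0.
(* The last entry of the maximum makes c M exceed the error terms C and (1 + c) r. *)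
pose M := maxn N (maxn r (Num.bound (c^-1 * (C%:R + (1 + c) * r%:R)))).
have cM : C%:R + (1 + c) * r%:R < c * M%:R.
  rewrite -ltr_pdivrMl //; apply: lt_le_trans (archi_boundP _) _.
    by rewrite mulr_ge0 ?invr_ge0 // addr_ge0 // mulr_ge0.
  by rewrite ler_nat !leq_max leqnn !orbT.
have [n Mn Tn] := sparse M.
have [Nn rn] : (N <= n)%N /\ (r <= n)%N.
  by split; apply: leq_trans Mn; rewrite !leq_max leqnn ?orbT.
have Mn' : M%:R <= n%:R :> R by rewrite ler_nat.
have rn' : r%:R <= n%:R :> R by rewrite ler_nat.
have d0 : 0 < n%:R - r%:R + 1 :> R by lra.
have := uN n Nn; rewrite /u ltr_pdivlMr // => bT.
have M0 : 0 < M%:R :> R.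
  by rewrite -(pmulr_rgt0 _ c0); apply: le_lt_trans cM; rewrite addr_ge0 // mulr_ge0.
have : g%:R * M%:R * (codegree_turan n k r)%:R <= n%:R * (M%:R + C%:R) :> R.
  by rewrite -natrD -!natrM ler_nat.
apply/negP; rewrite -ltNge.
have gM0 : 0 < g%:R * M%:R :> R by rewrite mulr_gt0.
have := bT; rewrite -(ltr_pM2l gM0); apply: le_lt_trans.
have -> : g%:R * M%:R * (b * (n%:R - r%:R + 1)) = M%:R * (1 + c) * (n%:R - r%:R + 1) :> R.
  by rewrite /c; ring.
(* With n >= M the error M (1 + c) r is at most n (1 + c) r. *)
have : n%:R * (C%:R + (1 + c) * r%:R) <= n%:R * (c * M%:R) :> R by rewrite ler_wpM2l // ltW.
have : M%:R * ((1 + c) * r%:R) <= n%:R * ((1 + c) * r%:R) :> R.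
  by rewrite ler_wpM2r // mulr_ge0.
have : 0 <= M%:R * (1 + c) :> R by rewrite mulr_ge0.
lra.
Qed.

Lemma codegree_turan_le (V : finType) (E : {set {set V}}) (k r D : nat) :
  (0 < r <= k)%N -> (forall e, e \in E -> #|e| = r) ->
  (forall S : {set V}, (k <= #|S|)%N -> exists2 e, e \in E & e \subset S) ->
  (forall A : {set V}, #|A| = r.-1 -> (#|[set x | (x \notin A) && (x |: A \in E)]| <= D)%N) ->
  (codegree_turan #|V| k r <= D)%N.
Proof.
move=> rk rE kE degE.
pose h := @enum_rank V; have injh : injective h := @enum_rank_inj V.
pose E' := [set h @: (e : {set V}) | e in E].
have cardh (A : {set 'I_#|V|}) : #|h @^-1: A| = #|A|.
  by rewrite on_card_preimset //; exact: onW_bij (enum_rank_bij V).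
have hK (A : {set 'I_#|V|}) : h @: (h @^-1: A) = A.
  apply/finset.setP => i; apply/imsetP/idP => [[x]|iA]; first by rewrite inE => ? ->.
  by exists (enum_val i); rewrite ?inE /h enum_valK.
have hV (A : {set V}) : h @^-1: (h @: A) = A.
  by apply/finset.setP => x; rewrite inE mem_imset.
apply: leq_trans ((codegree_turanP #|V| rk).2 E' _ _) _.
- by apply/forall_inP => _ /imsetP[e eE ->]; rewrite card_imset // rE.
- have k0 : (0 < k)%N by lia.
  rewrite -(prednK k0) ltnS; apply/bigmax_leqP => S indS.
  rewrite -ltnS prednK // ltnNge; apply/negP => kS.
  have [|e eE eS] := kE (h @^-1: S); first by rewrite cardh.
  have /negP[] := forall_inP indS _ (imset_f (fun e : {set V} => h @: e) eE).
  by rewrite -(hK S) imsetS.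
- apply/bigmax_leqP => A /eqP cA; rewrite /degree.
  have cA' : #|h @^-1: A| = r.-1 by rewrite cardh.
  apply: leq_trans (degE _ cA').
  set X := [set x | (x \notin _) && _]; rewrite -(card_imset X injh).
  have /subset_leq_card : [set e in E' | A \subset e] \subset
      [set i |: A | i in h @: (X : {set V})].
    apply/fintype.subsetP => _ /setIdP[/imsetP[e eE ->] Ae].
    have ce := rE e eE.
    have sAe : h @^-1: A \subset e by rewrite -(hV e) preimsetS.
    have : #|e :\: h @^-1: A| == 1%N by rewrite cardsDS // ce cA'; lia.
    case/cards1P=> x xE.
    have eE' : e = x |: h @^-1: A.
      by rewrite -xE finset.setUC -{1}(finset.setIidPr sAe) finset.setID.
    have /finset.setDP[_ xA] : x \in e :\: h @^-1: A by rewrite xE inE.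
    apply/imsetP; exists (h x); last by rewrite eE' imsetU1 hK.
    by apply: imset_f; rewrite inE xA -eE'.
  by move/leq_trans; apply; exact: leq_imset_card.
Qed.

(** Vertices carry a label in G, each label being shared by M vertices; the edges
    are the r-sets with label sum zero, so that r - 1 vertices of an edge determine
    the label of the last one. *)
Lemma codegree_turan_zero_sum (G : finZmodType) (k r M : nat) : (0 < r <= k)%N ->
  forces_zero_sum G k r -> (codegree_turan (#|G| * M) k r <= M)%N.
Proof.
move=> rk ZG; pose V := (G * 'I_M)%type.
pose E := [set e : {set V} | (#|e| == r) && (\sum_(x in e) x.1 == 0)].
have <- : #|{: V}| = (#|G| * M)%N by rewrite card_prod card_ord.
apply: (@codegree_turan_le V E) => //.
- by move=> e; rewrite inE => /andP[/eqP].
- move=> S /(ZG V (fun x => x.1))[e [eS ce se]]; exists e => //.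
  by rewrite inE ce se !eqxx.
- move=> A _; pose c := - \sum_(x in A) x.1.
  have /subset_leq_card : [set x | (x \notin A) && (x |: A \in E)] \subset
      [set (c, i) | i : 'I_M].
    apply/fintype.subsetP => -[a i]; rewrite !inE => /andP[xA /andP[_]].
    by rewrite big_setU1 //= addr_eq0 => /eqP ->; apply/imsetP; exists i.
  by move/leq_trans; apply; rewrite (leq_trans (leq_imset_card _ _)) // card_ord.
Qed.

Lemma density_le_zero_sum (R : realType) (G : finZmodType) (k r : nat) : (0 < r <= k)%N ->
  forces_zero_sum G k r -> codegree_turan_density R k r <= 1 / #|G|%:R.
Proof.
move=> rk ZG; have G0 : (0 < #|G|)%N by apply/card_gt0P; exists 0.
apply: (@codegree_turan_density_le R k r #|G| 0 G0) => M.
exists (#|G| * M)%N; first by rewrite leq_pmull.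
by rewrite addn0 leq_mul2l codegree_turan_zero_sum ?orbT.
Qed.

(** * Labels depending on the top vertex *)

(** A map from F_p to G whose fibres are as equal as divisibility permits. *)
Definition residue_label (G : finZmodType) (p : nat) (t : 'F_p) : G :=
  nth 0 (enum G) (t %% #|G|).

(** Elements of F_p with the same label are congruent modulo the order of G, hence
    are told apart by their quotients. *)
Lemma card_residue_label (G : finZmodType) (p : nat) (c : G) : prime p ->
  (#|[set t : 'F_p | residue_label G p t == c]| <= p %/ #|G| + 1)%N.
Proof.
move=> pp; have G0 : (0 < #|G|)%N by apply/card_gt0P; exists 0.
have ltFp (t : 'F_p) : (t < p)%N by have := ltn_ord t; rewrite [X in (_ < X)%N]Fp_cast.
have quoP (t : 'F_p) : (t %/ #|G| < (p %/ #|G|).+1)%N by rewrite ltnS leq_div2r // ltnW.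
rewrite addn1 -[X in (_ <= X)%N]card_ord.
rewrite -(card_in_imset (f := fun t : 'F_p => Ordinal (quoP t))) ?max_card //.
move=> s t; rewrite !inE => /eqP sc /eqP tc [] st; apply/val_inj => /=.
rewrite (divn_eq s #|G|) (divn_eq t #|G|) st; congr (_ + _)%N.
move: sc; rewrite -tc /residue_label => /eqP.
by rewrite nth_uniq ?enum_uniq -?cardE ?ltn_mod // => /eqP.
Qed.

Section LabelledOrder.
Variables (F : finFieldType) (G : finZmodType) (chi : F -> G) (r q : nat).
Hypothesis r2 : (2 <= r)%N.
Hypothesis chi_fiber : forall c : G, (#|[set t | chi t == c]| <= q)%N.

Let V : finType := ('rV[F]_r * F * F)%type.
Implicit Types (u v x a : V) (A B S : {set V}).

Definition vpoly v : {poly F} := rVpoly v.1.1.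
Definition vpoint v : F := v.1.2.
Definition vlevel v : F := v.2.

(** A line in the direction of w, which may depend on the point; point and level are
    kept, so that conditions on them are invariant. *)
Definition shift (w : F -> {poly F}) (t : F) v : V :=
  (v.1.1 + t *: poly_rV (w (vpoint v)), vpoint v, vlevel v).

Lemma vpoly_shift (w : F -> {poly F}) t v : (size (w (vpoint v)) <= r)%N ->
  vpoly (shift w t v) = vpoly v + t *: w (vpoint v).
Proof. by move=> sw; rewrite /vpoly /= linearD linearZ /= poly_rV_K. Qed.

Lemma shift_inj (w : F -> {poly F}) t : injective (shift w t).
Proof.
move=> [[y b] l] [[y' b'] l']; rewrite /shift /vpoint /vlevel /= => -[+ bb ->].
by rewrite bb => /addIr ->.
Qed.

(** Count the pairs consisting of a shift and a vertex that it sends into the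
    property: each shift is a bijection of D. *)
Lemma card_shift_le (w : F -> {poly F}) (D P : pred V) : (forall t v, D (shift w t v) = D v) ->
  (forall v, D v -> (#|[set t | P (shift w t v)]| <= q)%N) ->
  (#|F| * #|[set v | D v & P v]| <= #|[set v | D v]| * q)%N.
Proof.
move=> DD Pq.
have -> : (#|F| * #|[set v | D v & P v]| =
    \sum_(t : F) #|[set v | D v & P (shift w t v)]|)%N.
  rewrite -sum_nat_const; apply: eq_bigr => t _.
  have bij_shift : bijective (shift w t) by exact: injF_bij (@shift_inj w t).
  rewrite -(on_card_preimset (onW_bij _ bij_shift)).
  by apply: eq_card => v; rewrite !inE DD.
have -> : (\sum_(t : F) #|[set v | D v & P (shift w t v)]| =
    \sum_(v | D v) #|[set t | P (shift w t v)]|)%N.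
  transitivity (\sum_(t : F) \sum_(v | D v && P (shift w t v)) 1)%N.
    by apply: eq_bigr => t _; rewrite sum1dep_card.
  rewrite (exchange_big_dep D) /=; last by move=> t v _ /andP[].
  by apply: eq_bigr => v Dv; rewrite -sum1dep_card; apply: eq_bigl => t; rewrite Dv.
by rewrite cardsE -sum_nat_const; exact: leq_sum.
Qed.

Lemma card_affine_le (b m : F) (c : G) : m != 0 ->
  (#|[set t | chi (b + t * m)%R == c]| <= q)%N.
Proof.
move=> m0; apply: leq_trans (chi_fiber c).
have injm : injective (fun t => b + t * m) by move=> s t /addrI /(mulIf m0).
rewrite -[X in (X <= _)%N](card_imset _ injm); apply: subset_leq_card.
by apply/fintype.subsetP => _ /imsetP[t tc ->]; move: tc; rewrite !inE.
Qed.

(** The coefficients of the code list all coordinates of u, so that distinct vertices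
    have distinct codes. *)
Definition vcode u : {poly F} := vpoly u + vpoint u *: 'X^r + vlevel u *: 'X^(r.+1).

Lemma size_vcode u : (size (vcode u) <= r.+2)%N.
Proof.
rewrite /vcode !(leq_trans (size_polyD _ _)) // geq_max; apply/andP; split.
  rewrite !(leq_trans (size_polyD _ _)) // geq_max; apply/andP; split.
    by rewrite (leq_trans (size_poly _ _)) // ltnW.
  by rewrite (leq_trans (size_scale_leq _ _)) // size_polyXn.
by rewrite (leq_trans (size_scale_leq _ _)) // size_polyXn.
Qed.

Lemma vcode_inj : injective vcode.
Proof.
move=> u v uv.
have coefr (x : V) i : (r <= i)%N -> (vpoly x)`_i = 0.
  by move=> ri; rewrite nth_default // (leq_trans (size_poly _ _)).
have coefE (x : V) i : (vcode x)`_i =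
    (vpoly x)`_i + vpoint x * (i == r)%:R + vlevel x * (i == r.+1)%:R.
  by rewrite /vcode !coefD !coefZ !coefXn.
have point_eq : vpoint u = vpoint v.
  have := congr1 (fun s : {poly F} => s`_r) uv; rewrite /= !coefE !coefr // eqxx.
  by rewrite (ltn_eqF (ltnSn r)) !mulr0 !mulr1 !addr0 !add0r.
have level_eq : vlevel u = vlevel v.
  have := congr1 (fun s : {poly F} => s`_(r.+1)) uv; rewrite /= !coefE !coefr // eqxx.
  by rewrite (gtn_eqF (ltnSn r)) !mulr0 !mulr1 !add0r.
have poly_eq : vpoly u = vpoly v.
  by move: uv; rewrite /vcode point_eq level_eq => /addIr /addIr.
have row_eq : u.1.1 = v.1.1 by rewrite -(rVpolyK u.1.1) -(rVpolyK v.1.1) -/(vpoly u) poly_eq.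
move: row_eq point_eq level_eq; case: u v {uv poly_eq} => [[? ?] ?] [[? ?] ?].
by rewrite /vpoint /vlevel /= => -> -> ->.
Qed.

(** The summand (vpoly u)`_1 makes the label nearly equidistributed in u for a fixed x,
    even if the polynomial of x is far from equidistributed. *)
Definition vlabel u x : G := chi ((vpoly x).[(vcode u).[vpoint x]] + (vpoly u)`_1).

Definition separated A (b : F) : bool :=
  [forall u in A, forall v in A, ((vcode u).[b] == (vcode v).[b]) ==> (u == v)].

(** Here the polynomial of x varies along the product of the X - (vcode u).[x] over
    the u in A other than a fixed u0: only the label of u0 changes. *)
Lemma card_label_sum_le A (L : pred F) : #|A| = r ->
  (#|F| * #|[set x | L (vlevel x) && separated A (vpoint x) &
                     (\sum_(u in A) vlabel u x == 0)%R]| <=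
   #|[set x | L (vlevel x) && separated A (vpoint x)]| * q)%N.
Proof.
move=> cA; have /card_gt0P[u0 u0A] : (0 < #|A|)%N by rewrite cA ltnW.
pose w b : {poly F} := \prod_(u in A :\ u0) ('X - ((vcode u).[b])%:P).
have size_w b : (size (w b) <= r)%N.
  rewrite /w -big_enum size_prod_XsubC -cardE.
  by have := cardsD1 u0 A; rewrite u0A cA; lia.
apply: (card_shift_le w) => // x /andP[_ /forall_inP sep].
rewrite (_ : [set t | _] = [set t | chi ((vpoly x).[(vcode u0).[vpoint x]] + (vpoly u0)`_1
    + t * (w (vpoint x)).[(vcode u0).[vpoint x]]) ==
    - \sum_(u in A :\ u0) vlabel u x]).
  apply: card_affine_le.
  rewrite /w horner_prod; apply/prodf_neq0 => u /setD1P[uu0 uA].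
  rewrite hornerXsubC subr_eq0; apply: contraNneq uu0 => e.
  by have /forall_inP/(_ u uA) := sep u0 u0A; rewrite e eqxx /= eq_sym.
apply/finset.setP => t; rewrite !inE (big_setD1 u0) //= addr_eq0; congr (_ == _).
  by rewrite /vlabel vpoly_shift // hornerD hornerZ addrAC.
congr (- _); apply: eq_bigr => u uA; rewrite /vlabel vpoly_shift // hornerD hornerZ.
rewrite [(w _).[_]](_ : _ = 0) ?mulr0 ?addr0 //.
by rewrite /w horner_prod (big_setD1 u) //= hornerXsubC subrr mul0r.
Qed.

(** Here the polynomial of x varies along X - vpoint a, which does not change the
    value at vpoint a but changes the coefficient of X. *)
Lemma card_label_le a (L : pred F) (c : G) :
  (#|F| * #|[set x | L (vlevel x) & vlabel x a == c]| <= #|[set x | L (vlevel x)]| * q)%N.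
Proof.
pose w (_ : F) : {poly F} := 'X - (vpoint a)%:P.
have size_w b : (size (w b) <= r)%N by rewrite size_XsubC.
apply: (card_shift_le w (fun x => L (vlevel x))) => // x _.
rewrite (_ : [set t | _] =
  [set t | chi ((vpoly a).[(vcode x).[vpoint a]] + (vpoly x)`_1 + t * 1) == c]).
  by apply: card_affine_le; exact: oner_neq0.
apply/finset.setP => t; rewrite !inE /vlabel /vcode vpoly_shift //.
rewrite !hornerD !hornerZ hornerXsubC subrr mulr0 addr0.
by rewrite coefD coefZ coefB coefX coefC subr0 addrA.
Qed.

Lemma card_vertices : #|{: V}| = (#|F| ^ r.+2)%N.
Proof. by rewrite !card_prod card_mx mul1n !expnSr. Qed.

Lemma card_point (P : pred F) :
  #|[set x : V | P (vpoint x)]| = (#|[set b | P b]| * #|F| ^ r.+1)%N.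
Proof.
rewrite (_ : [set x | _] = finset.setX (finset.setX [set: 'rV[F]_r] [set b | P b]) [set: F]).
  by rewrite !cardsX !cardsT card_mx mul1n mulnAC mulnC -expnSr.
by apply/finset.setP => -[[y b] l]; rewrite !inE andbT.
Qed.

Lemma card_level (P : pred F) :
  #|[set x : V | P (vlevel x)]| = (#|[set l | P l]| * #|F| ^ r.+1)%N.
Proof.
rewrite (_ : [set x | _] = finset.setX [set: 'rV[F]_r * F] [set l | P l]).
  by rewrite !cardsX !cardsT card_prod card_mx mul1n mulnC -expnSr.
by apply/finset.setP => -[[y b] l]; rewrite !inE.
Qed.

Lemma card_bigcup_le (I T : finType) (A : {set I}) (B : I -> {set T}) :
  (#|\bigcup_(i in A) B i| <= \sum_(i in A) #|B i|)%N.
Proof.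
elim/big_rec2: _ => [|i n X _ IH]; first by rewrite cards0.
by rewrite (leq_trans (leq_card_setU _ _).1) // leq_add2l.
Qed.

(** Distinct codes are polynomials of degree at most r + 1, which agree at no more
    than r + 1 points. *)
Lemma card_not_separated A :
  (#|[set x : V | ~~ separated A (vpoint x)]| <= #|A| * #|A| * (r.+1 * #|F| ^ r.+1))%N.
Proof.
pose B (p : V * V) := [set x : V |
   (p.1 != p.2) && ((vcode p.1).[vpoint x] == (vcode p.2).[vpoint x])].
have /subset_leq_card : [set x : V | ~~ separated A (vpoint x)] \subset
    \bigcup_(p in finset.setX A A) B p.
  apply/fintype.subsetP => x; rewrite inE => /forall_inPn[u uA /forall_inPn[v vA]].
  rewrite negb_imply => /andP[e uv]; apply/bigcupP; exists (u, v); first by rewrite inE /= uA.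
  by rewrite inE uv.
move/leq_trans; apply; apply: leq_trans (card_bigcup_le _ _ _ _) _.
rewrite -cardsX -sum_nat_const; apply: leq_sum => -[u v] _; rewrite /B /=.
rewrite (card_point (fun b => (u != v) && ((vcode u).[b] == (vcode v).[b]))) leq_mul2r.
apply/orP; right; have [->|uv] /= := eqVneq u v.
  by rewrite eq_card0 // => b; rewrite !inE.
have nz : vcode u - vcode v != 0 by rewrite subr_eq0 (inj_eq vcode_inj).
have size_uv : (size (vcode u - vcode v)%R <= r.+2)%N.
  by rewrite (leq_trans (size_polyD _ _)) // size_polyN geq_max !size_vcode.
rewrite -ltnS; apply: leq_trans size_uv.
rewrite cardE; apply: max_poly_roots => //; last exact: enum_uniq.
by apply/allP => b; rewrite mem_enum inE => /eqP e; rewrite rootE hornerD hornerN e subrr.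
Qed.

(** A linear order of the vertices that refines the order of the levels. *)
Definition vrank v : nat := (enum_rank (vlevel v) * #|V| + enum_rank v)%N.

Lemma vrank_inj : injective vrank.
Proof.
move=> u v uv; apply/enum_rank_inj/val_inj => /=.
by rewrite -(modn_small (ltn_ord (enum_rank u))) -(modn_small (ltn_ord (enum_rank v)))
  -(modnMDl (enum_rank (vlevel u))) -(modnMDl (enum_rank (vlevel v)) (enum_rank v)) -!/(vrank _) uv.
Qed.

Lemma ltn_vrank u v : (enum_rank (vlevel u) < enum_rank (vlevel v))%N -> (vrank u < vrank v)%N.
Proof.
move=> uv; apply: (@leq_trans ((enum_rank (vlevel u)).+1 * #|V|)).
  by rewrite mulSn addnC /vrank ltn_add2l.
by rewrite (leq_trans _ (leq_addr _ _)) // leq_mul2r uv orbT.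
Qed.

Definition vtop v (B : {set V}) : bool := (v \in B) && [forall u in B, vrank u <= vrank v]%N.

Lemma vtop_exists B : (0 < #|B|)%N -> exists v, vtop v B.
Proof.
case/card_gt0P=> v0 v0B.
case: (arg_maxnP vrank v0B) => v vB maxv; exists v; rewrite /vtop (vB : v \in B) /=.
by apply/forall_inP.
Qed.

Lemma vtop_eq u v B : vtop u B -> vtop v B -> u = v.
Proof.
move=> /andP[uB /forall_inP maxu] /andP[vB /forall_inP maxv].
by apply/vrank_inj/eqP; rewrite eqn_leq maxu ?maxv.
Qed.

Definition top_edges : {set {set V}} :=
  [set B : {set V} | (#|B| == r.+1) &&
    [exists v, vtop v B && (\sum_(u in B :\ v) vlabel u v == 0)]].

Lemma top_edgesP v B : B \in top_edges -> vtop v B -> \sum_(u in B :\ v) vlabel u v = 0.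
Proof.
rewrite inE => /andP[_ /existsP[u /andP[ub /eqP sB]]] vb.
by rewrite (vtop_eq _ _ _ vb ub).
Qed.

Lemma top_edges_cover (k : nat) S : (r <= k)%N -> forces_zero_sum G k r ->
  (k.+1 <= #|S|)%N -> exists2 e, e \in top_edges & e \subset S.
Proof.
move=> rk ZG cS; have [v vS] := vtop_exists S (leq_trans (ltn0Sn _) cS).
have /andP[vinS /forall_inP maxv] := vS.
have [|e [eS ce se]] := ZG V (fun u => vlabel u v) (S :\ v).
  by have := cardsD1 v S; rewrite vinS; lia.
have ve : v \notin e by apply/negP => /(fintype.subsetP eS); rewrite !inE eqxx.
exists (v |: e); last first.
  by rewrite finset.subUset finset.sub1set vinS (fintype.subset_trans eS) ?subsetDl.
rewrite inE cardsU1 ve ce eqxx; apply/existsP; exists v.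
rewrite setU1K // se eqxx andbT /vtop setU11 /=; apply/forall_inP => u.
case/setU1P=> [->//|/(fintype.subsetP eS)/setD1P[_ uS]]; exact: maxv.
Qed.

(** An r-set A with top vertex a is completed by x to an edge in one of four ways:
    x has the level of a; some codes of A collide at the point of x; x lies above A,
    where its labels of A have sum zero; or x lies below a, where the label of x
    under a is determined by A. *)
Lemma top_edges_codegree A : #|A| = r ->
  (#|F| * #|[set x | (x \notin A) && (x |: A \in top_edges)]| <=
   #|V| * (q + 1 + r * r * r.+1))%N.
Proof.
move=> cA; have [a atop] : exists a, vtop a A by apply: vtop_exists; rewrite cA; lia.
have /andP[aA /forall_inP maxa] := atop.
pose hi (b : F) := (enum_rank (vlevel a) < enum_rank b)%N.
pose lo (b : F) := (enum_rank b < enum_rank (vlevel a))%N.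
pose c := - \sum_(u in A :\ a) vlabel u a.
pose Same := [set x : V | vlevel x == vlevel a].
pose Bad := [set x : V | ~~ separated A (vpoint x)].
pose Up := [set x : V | hi (vlevel x) && separated A (vpoint x) &
  (\sum_(u in A) vlabel u x == 0)%R].
pose Down := [set x : V | lo (vlevel x) & vlabel x a == c].
set X := [set x | _].
have XS : X \subset Same :|: Bad :|: (Up :|: Down).
  apply/fintype.subsetP => x /setIdP[xA xE]; rewrite !inE.
  have [//|/= la] := eqVneq (vlevel x) (vlevel a).
  have [sep|//] /= := boolP (separated A (vpoint x)); rewrite andbT.
  have : hi (vlevel x) || lo (vlevel x).
    rewrite /hi /lo -neq_ltn; apply: contraNneq la => e.
    by apply/eqP/enum_rank_inj/val_inj.
  case/orP=> [hx|lx].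
    rewrite hx (_ : \sum_(u in A) _ = 0) ?eqxx //.
    rewrite -[in LHS](setU1K xA); apply: top_edgesP xE _.
    rewrite /vtop setU11; apply/forall_inP => u /setU1P[->//|uA].
    by apply: leq_trans (maxa u uA) _; apply/ltnW/ltn_vrank.
  rewrite lx (_ : vlabel x a = c) ?eqxx ?orbT //.
  have xa : x != a by apply: contraNneq xA => ->.
  have : vtop a (x |: A).
    rewrite /vtop inE aA orbT /=; apply/forall_inP => u /setU1P[->|/maxa//].
    exact/ltnW/ltn_vrank.
  move=> /(top_edgesP a _ xE).
  have -> : (x |: A) :\ a = x |: (A :\ a).
    by apply/finset.setP => z; rewrite !inE; have [->|] := eqVneq z x; rewrite ?xa.
  by rewrite big_setU1 ?inE ?negb_and ?xA ?orbT //= => /eqP; rewrite addr_eq0 => /eqP.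
have cSame : (#|F| * #|Same| = #|V|)%N.
  by rewrite /Same (card_level (pred1 (vlevel a))) cardsE card1 mul1n -expnS card_vertices.
have cBad : (#|F| * #|Bad| <= #|V| * (r * r * r.+1))%N.
  apply: leq_trans (leq_mul (leqnn _) (card_not_separated A)) _.
  by rewrite card_vertices cA (expnS _ r.+1); lia.
have cUp : (#|F| * #|Up| <= _ * q)%N := card_label_sum_le A hi cA.
have cDown : (#|F| * #|Down| <= _ * q)%N := card_label_le a lo c.
have cHL : (#|[set x : V | hi (vlevel x) && separated A (vpoint x)]| +
    #|[set x : V | lo (vlevel x)]| <= #|V|)%N.
  set H := [set x | _]; set K := [set x | lo _].
  have -> : (#|H| + #|K| = #|H :|: K|)%N; last exact: max_card.
  rewrite cardsU disjoint_setI0 ?cards0 ?subn0 //; apply/pred0P => x /=.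
  by rewrite !inE /hi /lo; case: ltngtP; rewrite ?andbF.
have cX : (#|X| <= #|Same| + #|Bad| + (#|Up| + #|Down|))%N.
  apply: leq_trans (subset_leq_card XS) _.
  rewrite (leq_trans (leq_card_setU _ _).1) // leq_add // leq_card_setU //.
have := leq_mul (leqnn #|F|) cX; rewrite !mulnDr cSame => /leq_trans; apply.
have := leq_mul cHL (leqnn q); rewrite mulnDl => cHLq.
move: cBad cUp cDown cHLq; rewrite muln1; lia.
Qed.

End LabelledOrder.

Lemma codegree_turan_succ (G : finZmodType) (k r p : nat) : prime p -> (2 <= r <= k)%N ->
  forces_zero_sum G k r ->
  (p * codegree_turan (p ^ r.+2) k.+1 r.+1 <=
   p ^ r.+2 * (p %/ #|G| + 1 + 1 + r * r * r.+1))%N.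
Proof.
move=> pp /andP[r2 rk] ZG.
have fiber := @card_residue_label G p _ pp.
have cF : #|'F_p| = p by rewrite card_Fp.
have := @card_vertices 'F_p r; rewrite cF => cV.
rewrite -cV mulnC -leq_divRL ?prime_gt0 //.
apply: (@codegree_turan_le _ (top_edges 'F_p G (residue_label G p) r)).
- by rewrite ltnS.
- by move=> e; rewrite inE => /andP[/eqP].
- by move=> S; exact: top_edges_cover.
- move=> A cA; rewrite leq_divRL ?prime_gt0 // mulnC -[X in (X * _)%N]cF.
  exact: (top_edges_codegree 'F_p G _ r _ r2 fiber).
Qed.

(** Each estimate over F_p loses a summand of order n/p, which disappears as p
    grows. *)
Lemma density_le_zero_sum_succ (R : realType) (G : finZmodType) (k r : nat) :
  (2 <= r <= k)%N -> forces_zero_sum G k r ->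
  codegree_turan_density R k.+1 r.+1 <= 1 / #|G|%:R.
Proof.
move=> rk ZG; have G0 : (0 < #|G|)%N by apply/card_gt0P; exists 0.
apply: (@codegree_turan_density_le R k.+1 r.+1 #|G| (#|G| * (2 + r * r * r.+1)) G0) => M.
have [p Mp pp] := prime_above M; exists (p ^ r.+2)%N.
  by apply: leq_trans (ltnW Mp) _; rewrite expnS leq_pmulr // expn_gt0 prime_gt0.
set T := codegree_turan _ _ _; set n := (p ^ r.+2)%N; set K := (r * r * r.+1)%N.
have pT : (p * T <= n * (p %/ #|G| + 1 + 1 + K))%N by exact: codegree_turan_succ.
rewrite -(leq_pmul2l (prime_gt0 pp)).
have gq : (#|G| * (p %/ #|G|) <= p)%N by rewrite mulnC leq_divM.
apply: (@leq_trans (#|G| * M * (n * (p %/ #|G| + 1 + 1 + K)))).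
  by rewrite mulnCA leq_mul2l pT orbT.
apply: (@leq_trans (M * n * (p + #|G| * (2 + K)))).
  rewrite -!mulnA mulnCA leq_mul2l; apply/orP; right.
  rewrite mulnCA leq_mul2l; apply/orP; right.
  by rewrite !mulnDr; lia.
rewrite [(M * n)%N]mulnC -mulnA [X in (_ <= X)%N]mulnCA leq_mul2l; apply/orP; right.
set C := (#|G| * (2 + K))%N.
by rewrite !mulnDr [(p * M)%N]mulnC leq_add2l leq_mul2r ltnW ?orbT.
Qed.

(** * The three bounds *)

Theorem mainTheorem6 (R : realType) (r : nat) (hr : (4 <= r)%N) :
  [/\ codegree_turan_density R (r + 2) r <= 1 / 4,
      codegree_turan_density R (r + 3) r <= 1 / 8 &
      codegree_turan_density R (r + 5) r <= 1 / 16].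
Proof.
have bound (G : finZmodType) (d : nat) :
    (forall s, (4 <= s)%N -> ~~ odd s -> forces_zero_sum G (s + d) s) ->
    codegree_turan_density R (r + d) r <= 1 / #|G|%:R.
  move=> ZG; have [r_odd|r_even] := boolP (odd r); last first.
    by apply: density_le_zero_sum; [lia | exact: ZG].
  have r5 : (5 <= r)%N by move: r hr r_odd => [|[|[|[|[|]]]]].
  rewrite -(prednK (leq_trans (ltn0Sn _) r5)) addSn.
  apply: density_le_zero_sum_succ; first by lia.
  by apply: ZG; lia.
split.
- by have := bound _ _ forces_zero_sum_bool2; rewrite !card_prod card_bool.
- by have := bound _ _ forces_zero_sum_bool3; rewrite !card_prod card_bool.
- by have := bound _ _ forces_zero_sum_bool4; rewrite !card_prod card_bool.
Qed.
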